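(* Let $U\subseteq\mathbb K^n$ be open, let $f:U\to\mathbb K^n$ and $\theta:U\to\mathbb K$ be smooth, and let $k$ be a positive integer such that $\theta, X_f(\theta),\ldots,X_f^k(\theta)$ are functionally independent but $\theta,X_f(\theta),\ldots,X_f^k(\theta),X_f^{k+1}(\theta)$ are functionally dependent at all points of $U$. Let $\mu$ be a smooth function of $k+2$ variables (which exists by the implicit function theorem) such that $$\mu\bigl(\theta,X_f(\theta),\ldots,X_f^k(\theta),X_f^{k+1}(\theta)\bigr)=0\quad\text{on } U.$$ Denoting by $D_i$ the partial derivative with respect to the $i$-th variable, define $$U^*:=\{x\in U;\ D_{k+2}\,\mu(\theta(x),0,\ldots,0)\neq 0\}.$$ Then the subset $$Z:=\{x\in U^*;\ X_f(\theta)(x)=\cdots=X_f^{k+1}(\theta)(x)=0\}$$ is invariant for the restriction of $\dot x=f(x)$ to $U^*$.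
   Context: $\mathbb K$ is $\mathbb R$ or $\mathbb C$. For a smooth vector field $f$ on $U$, $X_f(\psi)(x)=D\psi(x)f(x)$ for smooth scalar-valued $\psi$, and $X_f^k$ is the $k$-fold iterate. Functions are functionally independent at a point if their differentials are linearly independent there, and functionally dependent otherwise. The function $\mu$ is understood to be smooth on an open subset of $\mathbb K^{k+2}$ containing all points $(\theta(x),X_f(\theta)(x),\ldots,X_f^{k+1}(\theta)(x))$, $x\in U$; in the definition of $U^*$ only those $x$ are considered for which $(\theta(x),0,\ldots,0)$ lies in the domain of $\mu$. (In order for the hypotheses to be satisfied, one may have to pass from an originally given open set to a suitable open subset $U$.) A subset of $U^*$ is invariant for the restriction of $\dot x=f(x)$ to $U^*$ if every solution in $U^*$ starting in the subset remains in it as long as it exists in $U^*$. *)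

(* Defs.v *)
From HB Require Import structures.
From mathcomp Require Import all_boot all_order all_algebra.
From mathcomp Require Import all_classical all_reals all_analysis.
From mathcomp Require Import complex.

Set Implicit Arguments.
Unset Strict Implicit.
Unset Printing Implicit Defensive.

Import Order.TTheory GRing.Theory Num.Theory.
Import numFieldNormedType.Exports.

Local Open Scope classical_set_scope.
Local Open Scope ring_scope.

(* Functions on an open subset of K^n are represented by total functions whose
   values outside that subset are irrelevant: everything below depends only on
   germs at points of the subset. *)

Section Smooth.
Variables (K : numFieldType) (n : nat) (W : normedModType K).
Implicit Types (A : set 'rV[K]_n) (g : 'rV[K]_n -> W).

(* C^m in the sense of differentiability over K; thus for K = C the smooth
   functions are the holomorphic ones. *)
Fixpoint Ck_on (m : nat) A g : Prop :=
  if m is m'.+1 then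
    (forall x, A x -> differentiable g x) /\
    (forall v, Ck_on m' A (fun x => 'D_v g x))
  else forall x, A x -> {for x, continuous g}.

Definition smooth_on A g : Prop := forall m, Ck_on m A g.

End Smooth.

Section VectorFields.
Variables (K : numFieldType) (n : nat).
Implicit Types (f : 'rV[K]_n -> 'rV[K]_n) (psi theta : 'rV[K]_n -> K).
Implicit Types (S U Z : set 'rV[K]_n).

Definition lie f psi : 'rV[K]_n -> K := fun x => 'd psi x (f x).

Definition lie_iter f (i : nat) psi : 'rV[K]_n -> K := iter i (lie f) psi.

Definition func_indep (m : nat) (g : 'I_m -> 'rV[K]_n -> K) (x : 'rV[K]_n) :
    bool :=
  free [tuple linfun ('d (g i) x : 'rV[K]_n -> K^o) | i < m].

Definition func_dep (m : nat) (g : 'I_m -> 'rV[K]_n -> K) (x : 'rV[K]_n) :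
    bool :=
  ~~ func_indep g x.

Definition lie_jet f theta (m : nat) (x : 'rV[K]_n) : 'rV[K]_m :=
  \row_(i < m) lie_iter f i theta x.

Definition partial (m : nat) (i : 'I_m) (mu : 'rV[K]_m -> K) (y : 'rV[K]_m) :
    K :=
  'D_(delta_mx 0 i) mu y.

(* The point (c, 0, ..., 0). *)
Definition first_axis (m : nat) (c : K) : 'rV[K]_m.+1 :=
  \row_(i < m.+1) if i == ord0 then c else 0.

(* W is the domain of mu. *)
Definition Ustar (k : nat) U theta (W : set 'rV[K]_k.+2) (mu : 'rV[K]_k.+2 -> K)
    : set 'rV[K]_n :=
  [set x | [/\ U x, W (first_axis k.+1 (theta x)) &
               partial ord_max mu (first_axis k.+1 (theta x)) != 0]].

Definition lie_zeros (k : nat) S f theta : set 'rV[K]_n :=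
  [set x | S x /\ forall i, (1 <= i <= k.+1)%N -> lie_iter f i theta x = 0].

(* Connected sets of times containing the initial time 0, open either in K or
   in the real line.  For K = R these are the open intervals around 0; for
   K = C both solutions in complex time and solutions in real time are
   included. *)
Definition time_domain (I : set K) : Prop :=
  [/\ I 0, connected I &
      exists2 O : set K, open O & I = O \/ I = O `&` [set t | t \is Num.real]].

(* phi : I -> S solves dx/dt = f(x); the derivative is taken along I. *)
Definition is_solution f S (I : set K) (phi : K -> 'rV[K]_n) : Prop :=
  forall t, I t -> S (phi t) /\
    (fun s => (s - t)^-1 *: (phi s - phi t)) @ within I t^' --> f (phi t).

Definition invariant_in f S Z : Prop :=
  forall (I : set K) (phi : K -> 'rV[K]_n),
    time_domain I -> is_solution f S I phi ->
    Z (phi 0) -> forall t, I t -> Z (phi t).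

End VectorFields.

(* Main.v *)
Require Import Defs.
From HB Require Import structures.
From mathcomp Require Import all_boot all_order all_algebra.
From mathcomp Require Import all_classical all_reals all_analysis.
From mathcomp Require Import complex.
From mathcomp Require Import lra.

Set Implicit Arguments.
Unset Strict Implicit.
Unset Printing Implicit Defensive.

Import Order.TTheory GRing.Theory Num.Theory.
Import numFieldNormedType.Exports.

Local Open Scope classical_set_scope.
Local Open Scope ring_scope.

(** Along a solution [phi] in [Ustar] put [u i t := lie_iter f i theta (phi t)].
    The chain rule gives the triangular system [u i' = u i.+1], and the relation
    [mu (u 0, ..., u k.+1) = 0] closes it. Indeed, at a time [t0] with
    [u 1 t0 = ... = u k.+1 t0 = 0] the point [P = (u 0 t0, 0, ..., 0)] is a zero
    of [mu] whose last partial derivative is nonzero, so differentiability of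
    [mu] at [P] alone bounds the last coordinate of any nearby zero of [mu],
    measured from [P], by a constant times the sum of the other ones
    ([implicit_bound]). Writing [y 0 = u 0 - u 0 t0] and [y i = u i] for [i > 0],
    this says [|y k.+1| <= C * (|y 0| + ... + |y k|)] near [t0], while each [y i]
    with [i <= k] has derivative [y i.+1] and vanishes at [t0]. A uniqueness
    argument in the style of Gronwall ([chain_vanish]) then makes all the [y i]
    vanish near [t0]. This takes the place of solving the relation for the last
    variable and invoking uniqueness for the resulting scalar equation of order
    [k.+1], of which the constant [u 0 t0] is a stationary solution.

    Hence the times spent in the zero set form a relatively open subset of the
    time domain; by continuity they form a relatively closed one as well, and the
    time domain is connected ([connected_clopen_ind]).

    The real and the complex case are treated at once, the second one with real
    as well as complex time: near [t0] the time domain contains the segment from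
    [t0] to [t], and the uniqueness argument runs along that segment, which is
    parametrized by the reals through an ordered embedding [iota : R -> K]. *)

(** * Smoothness of iterated Lie derivatives *)

Section Regularity.
Variable K : numFieldType.

Lemma differentiable_near_zero (V W : normedModType K) (g : V -> W) x :
  (\forall y \near x, g y = 0) -> differentiable g x.
Proof.
move=> g0; have gx : g x = 0 by exact: nbhs_singleton g0.
have go : g \o shift x = cst (g x) + \0 +o_ 0 id.
  apply/eqaddoP => e e0. near=> h.
  have -> : (g \o shift x - (cst (g x) + \0)) h = g (h + x).
    by rewrite -[LHS]/(g (h + x) - (g x + 0)) gx addr0 subr0.
  suff -> : g (h + x) = 0 by rewrite normr0 mulr_ge0 ?normr_ge0 ?(ltW e0).
  near: h; have /(_ _ g0) : (fun h : V => h + x) @ (0 : V) --> x.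
    by rewrite -[X in _ --> X]add0r; apply: cvgD; [exact: cvg_id|exact: cvg_cst].
  exact.
have dE := diff_unique (df := \0) (fun _ => cvg_cst _) go.
by apply/diff_locallyP; split; rewrite dE//; exact: cst_continuous.
Unshelve. all: by end_near. Qed.

(** Differentiability depends on the germ only. This and [Ck_on_congr] are what
    lets the product rule, which holds on the open set alone, be used under
    [Ck_on], whose derivatives are total functions. *)
Lemma near_eq_differentiable (V W : normedModType K) (g h : V -> W) x :
  (\forall y \near x, g y = h y) -> differentiable g x -> differentiable h x.
Proof.
move=> gh dg; rewrite (_ : h = g + (h - g)); last by rewrite addrC subrK.
apply: differentiableD => //; apply: differentiable_near_zero.
by apply: filterS gh => y ghy; rewrite -[LHS]/(h y - g y) ghy subrr.
Qed.

Variable n : nat.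
Implicit Types A : set 'rV[K]_n.

Lemma Ck_on_congr (W : normedModType K) m A (g h : 'rV[K]_n -> W) :
  open A -> (forall x, A x -> g x = h x) -> Ck_on m A g -> Ck_on m A h.
Proof.
move=> oA.
have near_gh (Y : Type) (g1 g2 : 'rV[K]_n -> Y) :
    (forall x, A x -> g1 x = g2 x) ->
    forall x, A x -> \forall y \near x, g1 y = g2 y.
  move=> g12 x Ax; apply: filterS (open_nbhs_nbhs (conj oA Ax)) => y.
  exact: g12.
elim: m g h => [|m IH] g h gh.
  move=> cg x Ax; have := cg x Ax.
  rewrite /prop_for /continuous_at -gh//; apply: cvg_trans.
  by apply: (@near_eq_cvg _ _ (nbhs x)); exact: near_gh _ _ _ gh x Ax.
move=> [dg Dg]; split=> [x Ax|v].
  by apply: near_eq_differentiable (near_gh _ _ _ gh x Ax) (dg x Ax).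
apply: IH (Dg v) => x Ax; exact: near_eq_derive (near_gh _ _ _ gh x Ax).
Qed.

Lemma Ck_onW (W : normedModType K) m A (g : 'rV[K]_n -> W) :
  Ck_on m.+1 A g -> Ck_on m A g.
Proof.
elim: m g => [|m IH] g [dg Dg].
  by move=> x Ax; exact: differentiable_continuous (dg x Ax).
by split=> // v; exact: IH.
Qed.

Lemma Ck_on_cst (W : normedModType K) m A (c : W) : Ck_on m A (fun=> c).
Proof.
elim: m c => [|m IH] c /=; first by move=> x _; exact: cst_continuous.
split=> [x _|v]; first exact: differentiable_cst.
rewrite [X in Ck_on _ _ X](_ : _ = fun=> 0)//.
by apply/funext => x; exact: derive_cst.
Qed.

Lemma Ck_onD (W : normedModType K) m A (g h : 'rV[K]_n -> W) :
  open A -> Ck_on m A g -> Ck_on m A h -> Ck_on m A (g + h).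
Proof.
move=> oA; elim: m g h => [|m IH] g h.
  by move=> cg ch x Ax; apply: continuousD; [exact: cg|exact: ch].
move=> [dg Dg] [dh Dh]; split=> [x Ax|v].
  by apply: differentiableD; [exact: dg|exact: dh].
apply: Ck_on_congr (IH _ _ (Dg v) (Dh v)) => // x Ax.
by rewrite deriveD//; apply: diff_derivable; [exact: dg|exact: dh].
Qed.

Lemma Ck_onM m A (g h : 'rV[K]_n -> K) :
  open A -> Ck_on m A g -> Ck_on m A h -> Ck_on m A (g * h).
Proof.
move=> oA; elim: m g h => [|m IH] g h.
  by move=> cg ch x Ax; apply: continuousM; [exact: cg|exact: ch].
move=> gC hC; have [dg Dg] := gC; have [dh Dh] := hC; split=> [x Ax|v].
  by apply: differentiableM; [exact: dg|exact: dh].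
apply: (@Ck_on_congr _ m A (g * (fun x => 'D_v h x) + h * (fun x => 'D_v g x))).
- by [].
- move=> x Ax.
  by rewrite deriveM//; apply: diff_derivable; [exact: dg|exact: dh].
- apply: Ck_onD => //.
  + by apply: IH; [exact: Ck_onW gC|exact: Dh].
  + by apply: IH; [exact: Ck_onW hC|exact: Dg].
Qed.

Lemma Ck_on_sum (W : normedModType K) m A p (g : 'I_p -> 'rV[K]_n -> W) :
  open A -> (forall i, Ck_on m A (g i)) -> Ck_on m A (\sum_(i < p) g i).
Proof.
move=> oA gC; elim/big_ind : _ => //; first exact: (Ck_on_cst m A (0 : W)).
by move=> ? ? ? ?; exact: Ck_onD.
Qed.

Lemma Ck_on_coord m A p (g : 'rV[K]_n -> 'rV[K]_p) j :
  open A -> Ck_on m A g -> Ck_on m A (fun x => g x 0 j).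
Proof.
have @L : {linear 'rV[K]_p -> K}.
  by exists (fun N : 'rV[K]_p => N 0 j); do 2![eexists]; do ?[constructor];
     rewrite ?mxE// => ? *; rewrite ?mxE//; move=> ?; rewrite !mxE.
have cL : continuous L by exact: coord_continuous.
move=> oA gC; rewrite -[X in Ck_on _ _ X]/(L \o g).
elim: m g gC => [|m IH] g.
  by move=> cg x Ax; apply: continuous_comp (cL _); exact: cg.
move=> [dg Dg]; have dL x : differentiable L x by exact: linear_differentiable.
have dLg x : A x -> differentiable (L \o g) x.
  by move=> Ax; exact: differentiable_comp (dg x Ax) (dL _).
split=> // v; apply: Ck_on_congr (IH _ (Dg v)) => // x Ax.
rewrite -[LHS]/(L ('D_v g x)) (deriveE v (dg x Ax)) (deriveE v (dLg x Ax)).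
by rewrite (diff_comp (dg x Ax) (dL _)) /= (diff_lin _ cL).
Qed.

(** In coordinates, [lie f psi] is the sum over [j] of the products of [f_j]
    with the [j]-th partial derivative of [psi], all of them smooth on [A]. *)
Lemma smooth_lie A f (psi : 'rV[K]_n -> K) :
  open A -> smooth_on A f -> smooth_on A psi -> smooth_on A (lie f psi).
Proof.
move=> oA fC psiC m.
apply: (@Ck_on_congr _ m A (\sum_(j < n) ((fun x => f x 0 j)
    * (fun x => 'D_(delta_mx 0 j) psi x)))) => //.
  move=> x Ax; have [dpsi _] := psiC 1%N.
  rewrite /lie (row_sum_delta (f x)) linear_sum fct_sumE.
  by apply: eq_bigr => j _; rewrite linearZ/= -deriveE//; exact: dpsi.
apply: Ck_on_sum => // j; apply: Ck_onM => //; first exact: Ck_on_coord.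
by have [_] := psiC m.+1; exact.
Qed.

Lemma smooth_lie_iter A f (psi : 'rV[K]_n -> K) i :
  open A -> smooth_on A f -> smooth_on A psi -> smooth_on A (lie_iter f i psi).
Proof.
by move=> oA fC psiC; elim: i => [//|i IH]; exact: smooth_lie.
Qed.

Lemma smooth_on_differentiable (W : normedModType K) A (g : 'rV[K]_n -> W) x :
  smooth_on A g -> A x -> differentiable g x.
Proof. by move=> /(_ 1%N)[dg _]; exact: dg. Qed.

End Regularity.

(** * Uniqueness on a real segment *)

Section GrowthBarrier.
Variable R : realType.

(** The hypothesis says that [v] grows at rate at most [v / 2], in a form that
    makes sense for sums of norms, which need not be differentiable. For every
    [e > 0] the line [w r = e * (1 + 2 * r)] is a barrier: it starts above [v],
    and where [v] meets it within the segment, [v] grows at rate at most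
    [3 * e / 2], hence less than the slope [2 * e] of [w]. So [v <= w]
    throughout, and [v 1 <= 3 * e]. *)
Lemma growth_vanish (v : R -> R) : v 0 <= 0 ->
  (forall s : R, 0 <= s <= 1 -> forall e : R, 0 < e -> \forall r \near s,
     0 <= r <= 1 -> `|v r - v s| <= `|r - s| * (v s / 2 + e)) ->
  v 1 <= 0.
Proof.
move=> v0 growth; rewrite leNgt; apply/negP => v1_gt0.
(* With this [e] the barrier ends at [w 1 = v 1 / 2], below [v 1]. *)
pose e := v 1 / 6; have e_gt0 : 0 < e by rewrite divr_gt0.
pose w r := e * (1 + 2 * r).
pose S := [set s : R | 0 <= s <= 1 /\ forall r, 0 <= r <= s -> v r <= w r].
have S0 : S 0.
  split=> [|r]; first by rewrite lexx ler01.
  move=> r0; have -> : r = 0 by apply/le_anti; rewrite andbC.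
  by rewrite /w mulr0 addr0 mulr1 (le_trans v0)// ltW.
have supS : has_sup S by split; [exists 0|exists 1 => s [/andP[]]].
pose sg := sup S.
have sg_ge0 : 0 <= sg by apply: ub_le_sup => //; case: supS.
have sg_le1 : sg <= 1 by apply: ge_sup; [exists 0|move=> s [/andP[]]].
have below r : 0 <= r < sg -> v r <= w r.
  move=> /andP[r0 rsg]; have d0 : 0 < sg - r by rewrite subr_gt0.
  have [s [_ +] rs] := sup_adherent d0 supS.
  by apply; rewrite r0/=; move: rs; rewrite subKr => /ltW.
(* By continuity [v] cannot jump over the barrier at the supremum. *)
have at_sg : v sg <= w sg.
  rewrite leNgt; apply/negP => vw.
  have [sg0|sgN0] := eqVneq sg 0.
    by move: vw; rewrite sg0 /w mulr0 addr0 mulr1 ltNge (le_trans v0)// ltW.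
  have sg_gt0 : 0 < sg by rewrite lt_def sgN0.
  have w_ge0 r : 0 <= r -> 0 <= w r by move=> ?; rewrite /w; nra.
  have vsg_gt0 : 0 < v sg by apply: le_lt_trans vw; exact: w_ge0.
  have := growth sg; rewrite sg_ge0 sg_le1 => /(_ isT 1 ltr01).
  move=> /nbhs_ballP[d /= d0 dP].
  pose m := Num.min (Num.min (d / 2) sg) ((v sg - w sg) / (v sg / 2 + 1) / 2).
  have m_gt0 : 0 < m.
    rewrite !lt_min sg_gt0 divr_gt0//= divr_gt0// divr_gt0 ?subr_gt0//.
    by lra.
  have md : m <= d / 2 by rewrite !ge_min lexx.
  have ms : m <= sg by rewrite !ge_min lexx orbT.
  have mv : m * (v sg / 2 + 1) <= (v sg - w sg) / 2.
    rewrite -ler_pdivlMr; last lra.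
    by rewrite mulrAC ge_min lexx orbT.
  have := dP (sg - m); rewrite /ball/= opprB addrC subrK gtr0_norm//.
  have -> : m < d by lra.
  have -> : 0 <= sg - m <= 1 by apply/andP; split; lra.
  have -> : `|sg - m - sg| = m by rewrite addrAC subrr add0r normrN gtr0_norm.
  move=> /(_ isT isT) gm.
  have := below (sg - m).
  have -> : 0 <= sg - m < sg by apply/andP; split; lra.
  move=> /(_ isT) vm; have wm : w (sg - m) <= w sg by rewrite /w; nra.
  have := ler_norm (- (v (sg - m) - v sg)); rewrite normrN; lra.
(* The margin [2 * e - (3 * e / 2 + e / 4)] leaves room to go beyond [sg]. *)
suff sg1 : sg = 1 by move: at_sg; rewrite sg1 /w /e; lra.
apply/eqP; rewrite eq_le sg_le1/= leNgt; apply/negP => sg_lt1.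
have := growth sg; rewrite sg_ge0 sg_le1 => /(_ isT (e / 4)).
rewrite divr_gt0// => /(_ isT)/nbhs_ballP[d /= d0 dP].
pose m := Num.min (d / 2) (1 - sg).
have m_gt0 : 0 < m by rewrite !lt_min divr_gt0//= subr_gt0.
have md : m <= d / 2 by rewrite !ge_min lexx.
have ms : m <= 1 - sg by rewrite !ge_min lexx orbT.
have Sm : S (sg + m).
  split=> [|r /andP[r0 rm]]; first by apply/andP; split; lra.
  have [rsg|sgr|->//] := ltgtP r sg; first by apply: below; rewrite r0.
  have := dP r; rewrite /ball/= distrC gtr0_norm ?subr_gt0//.
  have -> : r - sg < d by lra.
  have -> : 0 <= r <= 1 by apply/andP; split; lra.
  move=> /(_ isT isT) gr; have := ler_norm (v r - v sg).
  have rate : v sg / 2 + e / 4 <= 2 * e.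
    have : e * sg <= e by rewrite ger_pMr.
    by move: at_sg; rewrite /w; lra.
  have : (r - sg) * (v sg / 2 + e / 4) <= (r - sg) * (2 * e).
    by rewrite ler_wpM2l// subr_ge0 ltW.
  by move: at_sg; rewrite /w; lra.
have : sg + m <= sg by exact: ub_le_sup (proj2 supS) _ Sm.
by rewrite gerDl leNgt m_gt0.
Qed.

End GrowthBarrier.

(** * Induction over a connected set *)

Lemma connected_clopen_ind (T : topologicalType) (I : set T) (P : T -> Prop) x :
  connected I -> I x -> P x ->
  (forall t, I t -> P t -> \forall s \near t, I s -> P s) ->
  (forall t, I t -> ~ P t -> \forall s \near t, I s -> ~ P s) ->
  forall t, I t -> P t.
Proof.
move=> conI Ix Px openP openNP t It.
suff IP : I `&` P = I by move: It; rewrite -IP => -[].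
apply: conI; first by exists x.
- exists (interior [set s | I s -> P s]); first exact: open_interior.
  apply/seteqP; split=> s [Is].
    by move=> Ps; split=> //; exact: openP.
  by move=> /interior_subset/(_ Is).
- exists (~` interior [set s | I s -> ~ P s]).
    by rewrite closedC; exact: open_interior.
  apply/seteqP; split=> s [Is].
    by move=> Ps; split=> // /interior_subset/(_ Is).
  by move=> Ns; split=> //; apply: contrapT => NPs; apply: Ns; exact: openNP.
Qed.

(** * First-order estimates *)

Section FirstOrder.
Variable K : numFieldType.

Lemma differentiable_remainder (V W : normedModType K) (g : V -> W) x e :
  differentiable g x -> 0 < e ->
  \forall h \near 0, `|g (h + x) - g x - 'd g x h| <= e * `|h|.
Proof.
move=> dg e0; have /eqaddoP/(_ e e0) := diff_locally dg.
apply: filterS => h.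
by rewrite -[X in `|X| <= _ -> _]/(g (h + x) - (g x + 'd g x h)) opprD addrA.
Qed.

(** A chain rule for derivatives taken along [I], kept as an inequality between
    increments: this is all that the uniqueness argument uses, and unlike the
    difference quotient it also holds at [s = t]. *)
Lemma chain_rule_bound (V W : normedModType K) (I : set K) (phi : K -> V) t
    (w : V) (g : V -> W) e :
  (fun s => (s - t)^-1 *: (phi s - phi t)) @ within I t^' --> w ->
  differentiable g (phi t) -> 0 < e ->
  \forall s \near t, I s ->
    `|g (phi s) - g (phi t)| <= `|s - t| * (`|'d g (phi t) w| + e).
Proof.
move=> phi_w dg e0.
(* [q] bounds the slopes of [phi] near [t]. *)
pose q : K := `|w| + 1; have q0 : 0 < q by rewrite ltr_wpDl.
have e2 : 0 < e / 2 by rewrite divr_gt0.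
have := differentiable_remainder dg (divr_gt0 e2 q0).
move=> /nbhs_ballP[rho /= rho0 rhoP].
have dgw : ('d g (phi t) \o (fun s => (s - t)^-1 *: (phi s - phi t)))
    @ within I t^' --> 'd g (phi t) w.
  by apply: cvg_comp phi_w _; exact: diff_continuous dg w.
have slope_near : \forall s \near t, s != t -> I s ->
    `|w - (s - t)^-1 *: (phi s - phi t)| < 1.
  have : \forall s \near within I t^',
      `|w - (s - t)^-1 *: (phi s - phi t)| < 1.
    by move/cvgrPdist_lt : phi_w; apply.
  exact.
have dslope_near : \forall s \near t, s != t -> I s ->
    `|'d g (phi t) w - 'd g (phi t) ((s - t)^-1 *: (phi s - phi t))| < e / 2.
  have : \forall s \near within I t^',
    `|'d g (phi t) w - 'd g (phi t) ((s - t)^-1 *: (phi s - phi t))| < e / 2.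
    by move/cvgrPdist_lt : dgw; apply.
  exact.
have close : \forall s \near t, `|s - t| < rho / q.
  apply/nbhs_ballP; exists (rho / q); first by rewrite /= divr_gt0.
  by move=> s; rewrite /ball/= distrC.
near=> s.
have slope_s : s != t -> I s -> `|w - (s - t)^-1 *: (phi s - phi t)| < 1.
  by near: s.
have dslope_s : s != t -> I s ->
    `|'d g (phi t) w - 'd g (phi t) ((s - t)^-1 *: (phi s - phi t))| < e / 2.
  by near: s.
have close_s : `|s - t| < rho / q by near: s.
move=> Is; have [->|st] := eqVneq s t; first by rewrite !subrr !normr0 mul0r.
have st0 : 0 < `|s - t| by rewrite normr_gt0 subr_eq0.
set z := (s - t)^-1 *: (phi s - phi t).
have phiE : phi s - phi t = (s - t) *: z.
  by rewrite scalerA mulfV ?scale1r// subr_eq0.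
have zq : `|z| <= q.
  have zw : `|w - z| < 1 by exact: slope_s.
  rewrite -[z](subrK w) addrC (le_trans (ler_normD _ _))// lerD2l distrC.
  exact: ltW.
have dz : `|'d g (phi t) z| <= `|'d g (phi t) w| + e / 2.
  have dw : `|'d g (phi t) w - 'd g (phi t) z| < e / 2.
    by exact: dslope_s.
  rewrite -['d g (phi t) z](subrK ('d g (phi t) w)) addrC.
  by rewrite (le_trans (ler_normD _ _))// lerD2l distrC ltW.
have hq : `|phi s - phi t| <= `|s - t| * q by rewrite phiE normrZ ler_wpM2l.
have /rhoP /= : ball 0 rho (phi s - phi t).
  rewrite -ball_normE /= sub0r normrN (le_lt_trans hq)//.
  by rewrite -ltr_pdivlMr.
rewrite subrK => rem.
rewrite -[g (phi s) - _](subrK ('d g (phi t) (phi s - phi t))).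
rewrite (le_trans (ler_normD _ _))// [e in leRHS](splitr e) addrA mulrDr.
rewrite [leLHS]addrC lerD//.
  by rewrite {1}phiE linearZZ normrZ ler_wpM2l.
rewrite (le_trans rem)// -mulrA [leRHS]mulrC ler_wpM2l ?(ltW e2)//.
by rewrite ler_pdivrMl // mulrC.
Unshelve. all: by end_near. Qed.

Lemma chain_rule_cvg (V W : normedModType K) (I : set K) (phi : K -> V) t
    (w : V) (g : V -> W) e :
  (fun s => (s - t)^-1 *: (phi s - phi t)) @ within I t^' --> w ->
  differentiable g (phi t) -> 0 < e ->
  \forall s \near t, I s -> `|g (phi s) - g (phi t)| < e.
Proof.
move=> phi_w dg e0; have := chain_rule_bound phi_w dg ltr01.
set q := _ + 1; have q0 : 0 < q by rewrite ltr_wpDl.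
have close : \forall s \near t, `|s - t| < e / q.
  apply/nbhs_ballP; exists (e / q); first by rewrite /= divr_gt0.
  by move=> s; rewrite /ball/= distrC.
apply: filterS2 close => s st bound Is.
by rewrite (le_lt_trans (bound Is))// -ltr_pdivlMr.
Qed.

(** Near [P] the equation [mu = 0] determines the last coordinate up to a
    Lipschitz bound. From [0 = mu (h + P) - mu P = 'd mu P h + o(h)] with
    [d := partial ord_max mu P] nonzero, [|d| * |h_max|] is at most a multiple of
    the other coordinates plus [|o(h)|], and the part of the remainder coming
    from [h_max] itself is absorbed in the left-hand side. Differentiability at
    the single point [P] suffices. *)
Lemma implicit_bound m (mu : 'rV[K]_m.+1 -> K) (P : 'rV[K]_m.+1) :
  differentiable mu P -> mu P = 0 -> partial ord_max mu P != 0 ->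
  exists2 C : K, 0 <= C & \forall h \near (0 : 'rV[K]_m.+1), mu (h + P) = 0 ->
    `|h 0 ord_max| <= C * \sum_(i < m) `|h 0 (widen_ord (leqnSn m) i)|.
Proof.
move=> dmu muP; set d := partial _ _ _ => d_neq0.
have d0 : 0 < `|d| by rewrite normr_gt0.
(* [Q] compares the norm of [h] with the sum of its coordinates' norms, so that
   the remainder is at most [|d| / 2] times that sum. *)
pose Q : K := 1 + \sum_(i < m.+1) `|delta_mx 0 i : 'rV[K]_m.+1|.
have Q0 : 0 < Q by rewrite ltr_pwDl// sumr_ge0.
pose M : K := \sum_(i < m) `|partial (widen_ord (leqnSn m) i) mu P|.
have M0 : 0 <= M by rewrite sumr_ge0.
have d2 : 0 < `|d| / 2 by rewrite divr_gt0.
exists ((M + `|d| / 2) / (`|d| / 2)).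
  by rewrite divr_ge0 ?addr_ge0// ltW.
have := differentiable_remainder dmu (divr_gt0 d2 Q0).
apply: filterS => h + muh; rewrite muh muP subrr sub0r normrN => rem.
set S := \sum_(i < m) _.
have hQ : `|h| <= Q * (S + `|h 0 ord_max|).
  have -> : S + `|h 0 ord_max| = \sum_(i < m.+1) `|h 0 i|.
    by rewrite big_ord_recr.
  rewrite {1}(row_sum_delta h) (le_trans (ler_norm_sum _ _ _))//.
  rewrite mulr_sumr ler_sum// => i _; rewrite normrZ mulrC ler_wpM2r//.
  by rewrite /Q (bigD1 i)//= addrCA lerDl addr_ge0// sumr_ge0.
have dE : 'd mu P h = \sum_(i < m) h 0 (widen_ord (leqnSn m) i) *
    partial (widen_ord (leqnSn m) i) mu P + h 0 ord_max * d.
  rewrite {1}(row_sum_delta h) linear_sum big_ord_recr/= linearZZ.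
  rewrite /d /partial (deriveE _ dmu); congr (_ + _).
  by apply: eq_bigr => i _; rewrite linearZZ (deriveE _ dmu).
have lead : `|d| * `|h 0 ord_max| <= M * S + `|d| / 2 * (S + `|h 0 ord_max|).
  have -> : `|d| * `|h 0 ord_max| = `|h 0 ord_max * d| by rewrite normrM mulrC.
  rewrite -[h 0 ord_max * d](addrK (\sum_(i < m) h 0 (widen_ord (leqnSn m) i) *
    partial (widen_ord (leqnSn m) i) mu P)) [_ + \sum_(i < m) _]addrC -dE.
  rewrite addrC (le_trans (ler_normD _ _))// normrN lerD//.
    rewrite (le_trans (ler_norm_sum _ _ _))// mulr_sumr ler_sum// => i _.
    rewrite normrM mulrC ler_wpM2r// /M (bigD1 i)//= lerDl sumr_ge0//.
  by rewrite (le_trans rem)// -[leLHS]mulrA ler_wpM2l ?(ltW d2)// ler_pdivrMl.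
rewrite mulrAC ler_pdivlMr// mulrC.
rewrite -(lerD2r (`|d| / 2 * `|h 0 ord_max|)) -mulrDl -splitr.
by rewrite mulrDl -addrA -mulrDr.
Qed.

End FirstOrder.

(** * Uniqueness along a time domain *)

(** [iota] embeds the reals in [K] and [N] is the norm of [K] read in [R]; the
    order of [K] being partial, inequalities between norms are moved to [R]. *)
Section RealScalars.
Variables (R : realType) (K : numFieldType).
Variables (iota : {rmorphism R -> K}) (N : K -> R).
Hypothesis iota_le : {mono iota : x y / x <= y}.
Hypothesis iotaN : forall z, iota (N z) = `|z|.

Let iota_inj : injective iota.
Proof. by move=> x y xy; apply/le_anti; rewrite -!iota_le xy lexx. Qed.

Let iota_lt x y : (iota x < iota y) = (x < y).
Proof. by rewrite !lt_neqAle iota_le (inj_eq iota_inj). Qed.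

Let iota_ge0 x : (0 <= iota x) = (0 <= x).
Proof. by rewrite -(rmorph0 iota) iota_le. Qed.

Let N_ge0 z : 0 <= N z.
Proof. by rewrite -iota_ge0 iotaN. Qed.

Let N_eq0 z : N z <= 0 -> z = 0.
Proof.
by rewrite -iota_le iotaN rmorph0 normr_le0 => /eqP.
Qed.

Let N0 : N 0 = 0.
Proof. by apply: iota_inj; rewrite iotaN normr0 rmorph0. Qed.

Let NM a b : N (a * b) = N a * N b.
Proof. by apply: iota_inj; rewrite rmorphM !iotaN normrM. Qed.

Let N_iota x : N (iota x) = `|x|.
Proof.
apply: iota_inj; rewrite iotaN; have [x0|/ltW x0] := leP 0 x.
  by rewrite (ger0_norm x0) ger0_norm// iota_ge0.
by rewrite (ler0_norm x0) rmorphN ler0_norm// -(rmorph0 iota) iota_le.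
Qed.

Let N_dist a b : `|N a - N b| <= N (a - b).
Proof.
have Nle u w : N u <= N w + N (u - w).
  by rewrite -iota_le rmorphD !iotaN -{1}(subrK w u) addrC ler_normD.
have NC : N (a - b) = N (b - a) by apply: iota_inj; rewrite !iotaN distrC.
by rewrite ler_norml; have := Nle a b; have := Nle b a; rewrite -NC; lra.
Qed.

Let path (t0 t : K) (s : R) := t0 + iota s * (t - t0).

Let N_path t0 t r s : N (path t0 t r - path t0 t s) = `|r - s| * N (t - t0).
Proof.
by rewrite /path opprD addrACA subrr add0r -mulrBl -rmorphB NM N_iota.
Qed.

Let path_cvg t0 t (s : R) : path t0 t r @[r --> s] --> path t0 t s.
Proof.
apply/cvgrPdist_lt => e e0.
have eE : e = iota (N e) by rewrite iotaN gtr0_norm.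
have Ne0 : 0 < N e by rewrite -iota_lt -eE rmorph0.
have a0 : 0 < N (t - t0) + 1 by rewrite ltr_wpDl.
have d0 : 0 < N e / (N (t - t0) + 1) by rewrite divr_gt0.
near=> r; rewrite eE -iotaN iota_lt N_path.
have : `|s - r| < N e / (N (t - t0) + 1).
  near: r; apply/nbhs_ballP; exists (N e / (N (t - t0) + 1)) => //.
rewrite ltr_pdivlMr// mulrDr mulr1; apply: le_lt_trans.
by rewrite lerDl.
Unshelve. all: by end_near. Qed.

(** If [y i] has derivative [y i.+1] for [i < p] and [y p] is dominated by the
    earlier functions, then vanishing at [t0] propagates to nearby times. On the
    segment from [t0] to [t] the sum of the norms of the [y i], [i < p], grows at
    rate at most [|t - t0| * (1 + C)] times itself, and for [t] close to [t0]
    this is at most half of it, as [growth_vanish] demands. *)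
Lemma chain_vanish p (y : nat -> K -> K) (I O : set K) t0 C :
  open O -> I = O \/ I = O `&` [set t | t \is Num.real] -> I t0 ->
  (forall i, (i < p)%N -> forall t, I t -> forall e, 0 < e ->
     \forall s \near t, I s ->
       `|y i s - y i t| <= `|s - t| * (`|y i.+1 t| + e)) ->
  0 <= C ->
  (\forall t \near t0, I t -> `|y p t| <= C * \sum_(i < p) `|y i t|) ->
  (forall i, (i < p)%N -> y i t0 = 0) ->
  \forall t \near t0, I t -> forall i, (i <= p)%N -> y i t = 0.
Proof.
move=> oO IO It0 slope C0 closed y0.
have Ot0 : O t0 by case: IO It0 => -> // -[].
have [d /= d0 dP] : \forall t \near t0, O t /\
    (I t -> `|y p t| <= C * \sum_(i < p) `|y i t|).
  apply/nbhs_ballP; apply: filterI closed.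
  exact: open_nbhs_nbhs.
pose c := N C; have c0 : 0 <= c := N_ge0 C.
have CE : C = iota c by rewrite iotaN ger0_norm.
pose rad : R := (2 * (1 + c))^-1.
have rad0 : 0 < rad by rewrite invr_gt0; lra.
have near_rad : \forall t \near t0, `|t - t0| < iota rad.
  apply/nbhs_ballP; exists (iota rad).
    by rewrite /= -(rmorph0 iota) iota_lt.
  by move=> t; rewrite /ball/= distrC.
have near_d : \forall t \near t0, ball t0 d t.
  by apply/nbhs_ballP; exists d.
near=> t => It.
have t_rad : `|t - t0| < iota rad by near: t.
have t_d : ball t0 d t by near: t.
set a := N (t - t0).
have a_ge0 : 0 <= a := N_ge0 _.
have a_rad : a * (1 + c) <= 1 / 2.
  have : a < rad by rewrite -iota_lt iotaN.
  rewrite /rad invfM -ltr_pdivrMr ?invr_gt0 ?invrK; last lra.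
  by rewrite div1r; apply: ltW.
have a_le1 : a <= 1 by nra.
pose g := path t0 t.
have g1 : g 1 = t by rewrite /g /path rmorph1 mul1r addrC subrK.
have g_ball s : 0 <= s <= 1 -> ball t0 d (g s).
  move=> /andP[s0 s1]; move: t_d; rewrite -ball_normE/=; apply: le_lt_trans.
  rewrite distrC /g /path addrAC subrr add0r normrM [leRHS]distrC.
  rewrite ler_piMl// -iotaN N_iota ger0_norm// -(rmorph1 iota) iota_le//.
have Ig s : 0 <= s <= 1 -> I (g s).
  move=> s01; have [Og _] := dP _ (g_ball s s01).
  case: IO It It0 => -> //= -[_ t_real] [_ t0_real]; split=> //=.
  rewrite /g /path realD// realM ?realB// ger0_real// iota_ge0.
  by case/andP: s01.
pose v s := \sum_(i < p) N (y i (g s)).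
have v0 : v 0 <= 0.
  rewrite /v big1// => i _.
  by rewrite /g /path rmorph0 mul0r addr0 y0.
have yp s : 0 <= s <= 1 -> N (y p (g s)) <= c * v s.
  move=> s01; have [_ /(_ (Ig s s01))] := dP _ (g_ball s s01).
  rewrite -iota_le iotaN CE rmorphM rmorph_sum.
  by under eq_bigr do rewrite -iotaN.
have v_ge0 s : 0 <= v s by apply: sumr_ge0.
have shift_sum s : 0 <= s <= 1 ->
    \sum_(i < p) N (y i.+1 (g s)) <= (1 + c) * v s.
  move=> s01; have := yp s s01; have := N_ge0 (y 0 (g s)).
  have : N (y 0 (g s)) + \sum_(i < p) N (y i.+1 (g s)) = v s + N (y p (g s)).
    transitivity (\sum_(i < p.+1) N (y i (g s))).
      by rewrite big_ord_recl.
    by rewrite big_ord_recr.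
  lra.
have v1 : v 1 <= 0.
  apply: growth_vanish => // s s01 e e0.
  (* Each of the [p] slopes contributes one error term; [p.+1] avoids a case
     distinction at [p = 0]. *)
  pose e' := e / p.+1%:R.
  have e'0 : 0 < e' by rewrite divr_gt0.
  have slope_i (i : 'I_p) : \forall r \near s, I (g r) ->
      `|y i (g r) - y i (g s)| <= `|g r - g s| * (`|y i.+1 (g s)| + iota e').
    have ie0 : 0 < iota e' by rewrite -(rmorph0 iota) iota_lt.
    exact: path_cvg (slope i (ltn_ord i) _ (Ig s s01) _ ie0).
  have slopes := filter_forall (nbhs_filter s) slope_i.
  apply: filterS slopes => r slopes r01.
  have step (i : 'I_p) : `|N (y i (g r)) - N (y i (g s))| <=
      `|r - s| * a * (N (y i.+1 (g s)) + e').
    rewrite (le_trans (N_dist _ _))// -N_path -iota_le rmorphM rmorphD !iotaN.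
    exact: slopes (Ig r r01).
  rewrite /v -sumrB (le_trans (ler_norm_sum _ _ _))//.
  rewrite (le_trans (ler_sum _ (fun i _ => step i)))// -mulr_sumr -mulrA.
  rewrite ler_wpM2l// big_split/= sumr_const card_ord.
  have ep : e' *+ p <= e.
    by rewrite -mulr_natr mulrAC ler_pdivrMr// ler_pM2l// ler_nat.
  have ep0 : 0 <= e' *+ p by rewrite mulrn_wge0// ltW.
  have := shift_sum s s01; rewrite -/(v s) => sh.
  rewrite mulrDr lerD//.
    have := ler_wpM2l a_ge0 sh; have := ler_wpM2r (v_ge0 s) a_rad; lra.
  by rewrite (le_trans _ ep)// ler_piMl.
have yi i : (i < p)%N -> y i t = 0.
  move=> ip; apply: N_eq0; apply: le_trans v1.
  rewrite /v g1 (bigD1 (Ordinal ip))//= lerDl sumr_ge0//.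
move=> i; rewrite leq_eqVlt => /orP[/eqP->|]; last exact: yi.
apply: N_eq0; have := yp 1; rewrite g1 lexx ler01 => /(_ isT) /le_trans; apply.
by rewrite mulr_ge0_le0.
Unshelve. all: by end_near. Qed.

(** * Invariance of the common zero set *)

Lemma lie_zeros_invariant n k (U : set 'rV[K]_n) (f : 'rV[K]_n -> 'rV[K]_n)
    (theta : 'rV[K]_n -> K) (W : set 'rV[K]_k.+2) (mu : 'rV[K]_k.+2 -> K) :
  open U -> smooth_on U f -> smooth_on U theta ->
  (forall z, W z -> differentiable mu z) ->
  (forall x, U x -> mu (lie_jet f theta k.+2 x) = 0) ->
  invariant_in f (Ustar U theta W mu)
    (lie_zeros k (Ustar U theta W mu) f theta).
Proof.
move=> oU fC thetaC muC mu_jet I phi [I0 conI [V oV IV]] sol [_ Z0].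
pose u i t := lie_iter f i theta (phi t).
have Uphi t : I t -> U (phi t) by case/sol => -[].
have dlie i t : I t -> differentiable (lie_iter f i theta) (phi t).
  move=> /Uphi; apply: smooth_on_differentiable; exact: smooth_lie_iter.
have u_cvg i t e : I t -> 0 < e ->
    \forall s \near t, I s -> `|u i s - u i t| < e.
  move=> It; have [_ phi_t] := sol t It.
  exact: chain_rule_cvg phi_t (dlie i t It).
have u_slope i t e : I t -> 0 < e -> \forall s \near t, I s ->
    `|u i s - u i t| <= `|s - t| * (`|u i.+1 t| + e).
  move=> It; have [_ phi_t] := sol t It.
  exact: chain_rule_bound phi_t (dlie i t It).
pose P t := forall i, (1 <= i <= k.+1)%N -> u i t = 0.
suff PI : forall t, I t -> P t.
  by move=> t It; split; [have [] := sol t It|exact: PI].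
apply: (connected_clopen_ind conI I0 Z0) => t0 It0; last first.
  (* A nonzero [u i t0] stays nonzero by continuity. *)
  move=> /existsNP[i /not_implyP[ik /eqP ui0]].
  have ui_gt0 : 0 < `|u i t0| by rewrite normr_gt0.
  apply: filterS (u_cvg i t0 _ It0 ui_gt0) => s us Is /(_ i ik) us0.
  by have := us Is; rewrite us0 sub0r normrN ltxx.
move=> Pt0.
have [[_ WP dP] _] := sol t0 It0.
(* Only [u 0] needs centring: the other [u i] vanish at [t0]. *)
pose y i t := u i t - (if i == 0%N then u 0%N t0 else 0).
have yS i t : y i.+1 t = u i.+1 t by rewrite /y subr0.
have y_t0 i : (i < k.+2)%N -> y i t0 = 0.
  by case: i => [|i] ik; [rewrite /y subrr|rewrite yS Pt0].
have jetP : lie_jet f theta k.+2 (phi t0) = first_axis k.+1 (theta (phi t0)).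
  apply/rowP => -[[|i] ik]; rewrite !mxE//=.
  exact: (Pt0 i.+1).
have muP : mu (first_axis k.+1 (theta (phi t0))) = 0.
  by rewrite -jetP mu_jet//; exact: Uphi.
have [C C0 /nbhs_ballP[d /= d0 bound]] := implicit_bound (muC _ WP) muP dP.
pose h t := lie_jet f theta k.+2 (phi t) - first_axis k.+1 (theta (phi t0)).
have hE t (i : 'I_k.+2) : h t 0 i = y i t by rewrite !mxE.
have jet_close i : \forall t \near t0, I t -> `|u i t - u i t0| < d.
  exact: u_cvg.
have jets_close : \forall t \near t0, forall i : 'I_k.+2,
    I t -> `|u i t - u i t0| < d.
  exact: (filter_forall (nbhs_filter t0) (fun i : 'I_k.+2 => jet_close i)).
have : \forall t \near t0, I t -> forall i, (i <= k.+1)%N -> y i t = 0.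
  apply: (@chain_vanish k.+1 y I V t0 C) => //.
  (* The constant subtracted in [y 0] cancels in the increments. *)
  - move=> i ik t It e e0; apply: filterS (u_slope i t e It e0) => s + Is.
    by move=> /(_ Is); rewrite yS /y opprB addrA subrK.
  - apply: filterS jets_close => t close It.
    have : ball 0 d (h t).
      split=> // i j; rewrite /ball/= mxE sub0r normrN ord1 hE.
      have -> : y j t = u j t - u j t0; last exact: close.
      rewrite -[LHS]subr0 -[X in _ - X](y_t0 j (ltn_ord j)).
      by rewrite /y opprB addrA subrK.
    move=> /bound; rewrite /h subrK => /(_ (mu_jet _ (Uphi t It))).
    rewrite -/(h t) hE /=.
    by under eq_bigr do rewrite hE.
  - by move=> i ik; exact: y_t0 (ltnW ik).
apply: filterS => t yt It i /andP[i0 ik].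
by rewrite -(prednK i0) -yS prednK//; exact: yt.
Qed.

End RealScalars.

Lemma real_scalars (R : realType) (K : numFieldType) :
  K = (R : numFieldType) \/ K = (R[i] : numFieldType) ->
  exists (iota : {rmorphism R -> K}) (N : K -> R),
    {mono iota : x y / x <= y} /\ forall z, iota (N z) = `|z|.
Proof.
case=> ->; first by exists idfun, Num.norm.
exists (real_complex R : {rmorphism R -> R[i]}), (fun z => complex.Re `|z|).
split; first by move=> x y; rewrite lecR.
by move=> z; exact: RRe_real (normr_real z).
Qed.

Theorem proposition2 (R : realType) (K : numFieldType)
  (HK : K = (R : numFieldType) \/ K = (R[i] : numFieldType))
  (n k : nat) (k_gt0 : (0 < k)%N)
  (U : set 'rV[K]_n) (U_open : open U)
  (f : 'rV[K]_n -> 'rV[K]_n) (f_smooth : smooth_on U f)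
  (theta : 'rV[K]_n -> K) (theta_smooth : smooth_on U theta)
  (indep : forall x, U x ->
     func_indep (fun i : 'I_k.+1 => lie_iter f i theta) x)
  (dep : forall x, U x ->
     func_dep (fun i : 'I_k.+2 => lie_iter f i theta) x)
  (W : set 'rV[K]_k.+2) (W_open : open W)
  (mu : 'rV[K]_k.+2 -> K) (mu_smooth : smooth_on W mu)
  (jet_W : forall x, U x -> W (lie_jet f theta k.+2 x))
  (mu_jet : forall x, U x -> mu (lie_jet f theta k.+2 x) = 0) :
  invariant_in f (Ustar U theta W mu)
    (lie_zeros k (Ustar U theta W mu) f theta).
Proof.
have [iota [N [iota_le iotaN]]] := real_scalars HK.
apply: (lie_zeros_invariant iota_le iotaN) => // z.
exact: smooth_on_differentiable.
Qed.
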